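(* There is no single rule for the quadrature that recovers every latent signal from its real observation: there does not exist a map $\mathcal{L}$ from real signals $\mathbb{R}\to\mathbb{R}$ to real signals $\mathbb{R}\to\mathbb{R}$ such that for every complex signal $z:\mathbb{R}\to\mathbb{C}$, with observation $x(t)=\Re\{z(t)\}$, one has $z(t)=x(t)+j\,\mathcal{L}\{x\}(t)$ for all $t\in\mathbb{R}$.
   Context: Here $j$ is the imaginary unit. A latent signal is a complex-valued function of time $z(t)=x(t)+jy(t)$, $t\in\mathbb{R}$, with $x,y$ real-valued; only its real part $x(t)=\Re\{z(t)\}$ is observed, and the imaginary part $y$ is called the quadrature. A rule for the quadrature is a map $\mathcal{L}$ that assigns to each observed real signal $x$ a real signal $\hat y=\mathcal{L}\{x\}$, giving the estimate $\hat z(t)=x(t)+j\hat y(t)$ of the latent signal; the rule obtains the latent signal $z$ if $\hat z=z$. *)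

(* Defs.v *)
From Stdlib Require Import Reals.
From Coquelicot Require Import Complex.
Open Scope R_scope.

Definition real_signal : Type := R -> R.

Definition complex_signal : Type := R -> C.

Definition observation (z : complex_signal) : real_signal := fun t => Re (z t).

Definition quadrature_rule : Type := real_signal -> real_signal.

Definition latent_estimate (L : quadrature_rule) (x : real_signal) :
    complex_signal :=
  fun t => (RtoC (x t) + Ci * RtoC (L x t))%C.

(* Equality of signals is taken pointwise, for all times. *)
Definition obtains (L : quadrature_rule) (z : complex_signal) : Prop :=
  forall t : R, latent_estimate L (observation z) t = z t.

(* Main.v *)
Require Import Defs.
From Stdlib Require Import Reals Lra.
From Coquelicot Require Import Complex.
Open Scope R_scope.

(** A rule sees only the real part, so it assigns one quadrature to all latent signals sharing it.
    Two such signals with different imaginary parts cannot both be obtained; [Im_latent_estimate]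
    isolates the quadrature for this comparison. *)

Lemma Im_latent_estimate (L : quadrature_rule) (x : real_signal) (t : R) :
  Im (latent_estimate L x t) = L x t.
Proof. unfold latent_estimate; simpl; ring. Qed.

(* The constant signals 0 and j have the same observation. *)
Theorem mainTheorem2 :
  ~ (exists L : quadrature_rule, forall z : complex_signal, obtains L z).
Proof.
  intros [L HL].
  pose proof (f_equal Im (HL (fun _ => RtoC 0) 0)) as H0.
  pose proof (f_equal Im (HL (fun _ => Ci) 0)) as H1.
  rewrite Im_latent_estimate in H0, H1.
  (* Both observations are convertible to [fun _ => 0], so the same value of [L] is forced to be 0
     and 1. *)
  change (L (fun _ => 0) 0 = 0) in H0.
  change (L (fun _ => 0) 0 = 1) in H1.
  lra.
Qed.
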